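(* Let $\mathcal{V}=(V,\langle\cdot,\cdot\rangle,J,R)$ be complex Osserman. Then $\mathcal{V}$ is Einstein, i.e. there is a constant $c\in\mathbb{R}$ with $\rho(\cdot,\cdot)=c\,\langle\cdot,\cdot\rangle$, where $\rho$ is the Ricci tensor of $R$.
   Context: $V$ is a finite-dimensional real vector space. A Hermitian almost complex structure on $(V,\langle\cdot,\cdot\rangle)$ is a linear isometry $J$ with $J^2=-\operatorname{id}$. An algebraic curvature tensor is $R\in\otimes^4V^*$ with $R(x,y,z,t)=-R(y,x,z,t)=R(z,t,x,y)$ and $R(x,y,z,t)+R(y,z,x,t)+R(z,x,y,t)=0$. Its Jacobi operator is the linear map $\mathcal{J}_R(x)$ on $V$ determined by $\langle\mathcal{J}_R(x)y,z\rangle=R(y,x,x,z)$. The Ricci tensor is the symmetric bilinear form $\rho$ with $\rho(x,x)=\operatorname{Tr}\{\mathcal{J}_R(x)\}$. For a unit vector $x$ put $\pi_x:=\operatorname{Span}\{x,Jx\}$ and $\mathcal{J}_R(\pi_x):=\mathcal{J}_R(x)+\mathcal{J}_R(Jx)$. The quadruple $(V,\langle\cdot,\cdot\rangle,J,R)$ is called complex Osserman if $\langle\cdot,\cdot\rangle$ is a positive definite inner product, $J$ is a Hermitian almost complex structure, $R$ is an algebraic curvature tensor, $J$ and $R$ are compatible, i.e. $\mathcal{J}_R(\pi_x)J=J\mathcal{J}_R(\pi_x)$ for all unit vectors $x$ (equivalently $R(x,y,z,t)=R(Jx,Jy,Jz,Jt)$ for all $x,y,z,t\in V$), and the eigenvalues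 of $\mathcal{J}_R(\pi_x)$ do not depend on the unit vector $x$. *)

(* Defs.v *)
From HB Require Import structures.
From mathcomp Require Import all_boot all_order all_algebra.
From mathcomp Require Import boolp classical_sets reals.
From mathcomp Require Import ring lra.

Set Implicit Arguments.
Unset Strict Implicit.
Unset Printing Implicit Defensive.

Import Order.TTheory GRing.Theory Num.Theory.
Local Open Scope ring_scope.

Section CurvatureModel.
Context {R : realType} {V : vectType R}.
Implicit Types (g : {dot V for idfun}) (J : 'End(V)).
Implicit Types (Rm : V -> V -> V -> V -> R) (rho : V -> V -> R).

Definition unit_vector g (x : V) : Prop := g x x = 1.

Definition hermitian_almost_complex g J : Prop :=
  isometry g g J /\ (J \o J = - \1)%VF.

Definition multilinear4 Rm : Prop :=
  [/\ forall y z t, scalar (fun x => Rm x y z t),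
      forall x z t, scalar (fun y => Rm x y z t),
      forall x y t, scalar (fun z => Rm x y z t)
    & forall x y z, scalar (fun t => Rm x y z t)].

Definition algebraic_curvature_tensor Rm : Prop :=
  [/\ multilinear4 Rm,
      forall x y z t, Rm x y z t = - Rm y x z t,
      forall x y z t, Rm x y z t = Rm z t x y
    & forall x y z t, Rm x y z t + Rm y z x t + Rm z x y t = 0].

(* The operator is pinned down by its defining equation; [jacobiE] and        *)
(* [jacobi_unique] show that it exists and is unique, so the default value 0  *)
(* is irrelevant.                                                             *)
Definition jacobi g Rm (x : V) : 'End(V) :=
  xget 0 [set A : 'End(V) | forall y z, g (A y) z = Rm y x x z].

Definition jacobi_plane g J Rm (x : V) : 'End(V) :=
  jacobi g Rm x + jacobi g Rm (J x).

Definition lfun_trace (A : 'End(V)) : R :=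
  \tr (passmx.mxof (vbasis {:V}) (vbasis {:V}) A).

Definition symmetric_bilinear rho : Prop :=
  [/\ forall y, scalar (fun x => rho x y),
      forall x, scalar (rho x)
    & forall x y, rho x y = rho y x].

(* As for [jacobi], see [ricciP] and [ricci_unique].                          *)
Definition ricci g Rm : V -> V -> R :=
  xget (fun _ _ => 0)
    [set rho | symmetric_bilinear rho
             /\ forall x, rho x x = lfun_trace (jacobi g Rm x)].

(* Eigenvalues are compared as sets, without multiplicities: the operators    *)
(* [jacobi_plane g J Rm x] are self-adjoint and depend continuously on [x],   *)
(* so over the connected unit sphere this fixes the multiplicities as well.   *)
Definition complex_osserman g J Rm : Prop :=
  [/\ hermitian_almost_complex g J,
      algebraic_curvature_tensor Rm,
      forall x, unit_vector g x ->
        (jacobi_plane g J Rm x \o J = J \o jacobi_plane g J Rm x)%VF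
    & forall x y, unit_vector g x -> unit_vector g y ->
        forall a : R, passmx.leigenvalue (jacobi_plane g J Rm x) a
                    = passmx.leigenvalue (jacobi_plane g J Rm y) a].

Definition einstein g Rm : Prop :=
  exists c : R, forall x y, ricci g Rm x y = c * g x y.

Lemma dot_inj g (u v : V) : (forall z, g u z = g v z) -> u = v.
Proof.
move=> uv; apply/eqP; rewrite -subr_eq0.
apply/negPn/negP => /(neq0_dnorm_gt0 (s := g)).
by rewrite linearBl /= uv subrr ltxx.
Qed.

Lemma riesz g (f : V -> R) : scalar f -> exists v : V, forall z, g v z = f z.
Proof.
move=> fl.
pose gl u : {linear V -> R^o} := HB.pack (g u : V -> R^o)
  (GRing.isLinear.Build R V R^o _ (g u : V -> R^o)
     (fun a x y => (linearP (g u) a x y : _))).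
pose fL : {linear V -> R^o} := HB.pack (f : V -> R^o)
  (GRing.isLinear.Build R V R^o _ (f : V -> R^o) fl).
have flat_lin : linear (fun u => linfun (gl u)).
  move=> a u v; apply/lfunP => z.
  by rewrite add_lfunE scale_lfunE !lfunE /= linearPl.
pose flatL : {linear V -> 'Hom(V, R^o)} :=
  HB.pack (fun u => linfun (gl u)) (GRing.isLinear.Build R V _ _ _ flat_lin).
pose flat := linfun flatL.
have flatE u z : flat u z = g u z by rewrite lfunE /= lfunE.
have ker0 : lker flat == 0%VS.
  apply/lker0P => u v uv; apply: (dot_inj (g := g)) => z.
  by rewrite -!flatE uv.
have im : limg flat = fullv.
  apply/eqP; rewrite eqEdim subvf limg_dim_eq; last first.
    by rewrite (eqP ker0) capv0.
  by rewrite !dimvf /= /dim /= muln1.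
have /memv_imgP[v _ ev] : linfun fL \in limg flat by rewrite im memvf.
by exists v => z; rewrite -flatE -ev lfunE.
Qed.

Lemma riesz2 g (B : V -> V -> R) :
  (forall z, scalar (fun y => B y z)) -> (forall y, scalar (B y)) ->
  exists A : 'End(V), forall y z, g (A y) z = B y z.
Proof.
move=> Bl Br.
have [h hE] := choice (fun y => riesz g (Br y)).
have hl : linear h.
  move=> a u v; apply: (dot_inj (g := g)) => z.
  by rewrite linearPl /= !hE Bl.
pose hL : {linear V -> V} := HB.pack h (GRing.isLinear.Build R V V _ h hl).
by exists (linfun hL) => y z; rewrite lfunE /= hE.
Qed.

Lemma jacobiE g Rm x y z : algebraic_curvature_tensor Rm ->
  g (jacobi g Rm x y) z = Rm y x x z.
Proof.
move=> [[l1 l2 l3 l4] _ _ _]; rewrite /jacobi.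
set P := [set _ | _]%classic.
have : P (xget 0 P).
  by apply: xgetPex; apply: riesz2 => t; [exact: l1 | exact: l4].
exact.
Qed.

Lemma jacobi_unique g Rm x (A : 'End(V)) : algebraic_curvature_tensor Rm ->
  (forall y z, g (A y) z = Rm y x x z) -> A = jacobi g Rm x.
Proof.
move=> RmP AE; apply/lfunP => y; apply: (dot_inj (g := g)) => z.
by rewrite AE jacobiE.
Qed.

Lemma lfun_traceP (a : R) (A B : 'End(V)) :
  lfun_trace (a *: A + B) = a * lfun_trace A + lfun_trace B.
Proof. by rewrite /lfun_trace passmx.mxof_linear mxtraceD mxtraceZ. Qed.

Lemma ricciP g Rm : algebraic_curvature_tensor Rm ->
  symmetric_bilinear (ricci g Rm)
  /\ forall x, ricci g Rm x x = lfun_trace (jacobi g Rm x).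
Proof.
move=> RmP; have [[l1 l2 l3 l4] _ _ _] := RmP; rewrite /ricci.
set P := [set _ | _]%classic.
suff : P (xget (fun _ _ => 0) P) by [].
apply: xgetPex.
pose B (p : V * V) y z := 2^-1 * (Rm y p.1 p.2 z + Rm y p.2 p.1 z).
have Bex p : exists A : 'End(V), forall y z, g (A y) z = B p y z.
  apply: riesz2 => [z|y] a u v; rewrite /B /=.
    by rewrite !l1 /=; ring.
  by rewrite !l4 /=; ring.
have [M ME] := choice Bex.
have Msym x y : M (x, y) = M (y, x).
  by apply/lfunP => u; apply: (dot_inj (g := g)) => z; rewrite !ME /B /= addrC.
have Ml y a u v : M (a *: u + v, y) = a *: M (u, y) + M (v, y).
  apply/lfunP => w; apply: (dot_inj (g := g)) => z.
  rewrite add_lfunE scale_lfunE linearPl /= !ME /B /= l2 l3 /=.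
  ring.
exists (fun x y => lfun_trace (M (x, y))); split; first split.
- by move=> y a u v; rewrite Ml lfun_traceP.
- by move=> x a u v; rewrite !(Msym x) Ml lfun_traceP.
- by move=> x y; rewrite Msym.
- move=> x; congr lfun_trace; apply: jacobi_unique => // y z.
  by rewrite ME /B /=; field.
Qed.

Lemma ricci_unique g Rm rho : algebraic_curvature_tensor Rm ->
  symmetric_bilinear rho ->
  (forall x, rho x x = lfun_trace (jacobi g Rm x)) ->
  forall x y, rho x y = ricci g Rm x y.
Proof.
have pol (b : V -> V -> R) x y : symmetric_bilinear b ->
    b x y *+ 2 = b (x + y) (x + y) - b x x - b y y.
  move=> [bl br bs].
  have bD u v w : b (u + v) w = b u w + b v w.
    by have := bl w 1 u v; rewrite /= scale1r mul1r.
  rewrite bD !(bs _ (x + y)) !bD (bs y x); ring.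
move=> RmP rhoP rhoE x y; have [ricP ricE] := ricciP g RmP.
suff : rho x y *+ 2 = ricci g Rm x y *+ 2 by lra.
by rewrite !pol // !rhoE !ricE.
Qed.

End CurvatureModel.

(* Main.v *)
(** The operators [jacobi_plane x] are self-adjoint, so each trace is a sum of
    [dim V] elements of one fixed finite set of eigenvalues. Hence a quadratic
    form (twice the Ricci form, once [jacobi (J x)] is seen to be conjugate to
    [jacobi x]) takes finitely many values on the unit sphere. Restricted to a
    line, such a form is a polynomial, so it is a constant multiple of the
    metric; this replaces the usual continuity argument on the sphere. *)

Require Import Defs.
From mathcomp Require Import all_boot all_order all_algebra.
From mathcomp Require Import reals.
From mathcomp Require Import boolp ring lra complex.

Local Open Scope ring_scope.

Set Implicit Arguments.
Unset Strict Implicit.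
Unset Printing Implicit Defensive.

Import Order.TTheory GRing.Theory Num.Theory passmx.

(** * Spectra and traces of self-adjoint operators *)

Section SymmetricOperators.
Context {R : realType} {V : vectType R}.
Implicit Types (g : {dot V for idfun}) (A B : 'End(V)).

Local Notation e := (vbasis {:V}).
Local Notation Cx := (real_complex R).

Lemma dotC g u v : g u v = g v u.
Proof. by rewrite hermC expr0 mul1r. Qed.

Lemma dot_gt0 g u : (0 < g u u) = (u != 0).
Proof.
apply/idP/idP; last exact: neq0_dnorm_gt0.
by apply: contraTneq => ->; rewrite linear0 ltxx.
Qed.

Lemma dot_ge0 g u : 0 <= g u u.
Proof.
have [->|u0] := eqVneq u 0; first by rewrite linear0.
by rewrite ltW // dot_gt0.
Qed.

Lemma dot_norm g v : v != 0 ->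
  exists2 s : R, 0 < s & exists2 u, unit_vector g u & v = s *: u.
Proof.
rewrite -(dot_gt0 g) => v0; have s0 : 0 < Num.sqrt (g v v) by rewrite sqrtr_gt0.
exists (Num.sqrt (g v v)) => //; exists ((Num.sqrt (g v v))^-1 *: v).
  rewrite /unit_vector linearZl_LR linearZ /= -{3}(sqr_sqrtr (ltW v0)).
  by field; rewrite gt_eqF.
by rewrite scalerA divff ?scale1r // gt_eqF.
Qed.

(** The pair consists of the real and imaginary parts of a complex row eigenvector; since [M] is
    real, the eigenvalue equation separates into two real ones. *)
Lemma complex_eigenvalue_split n (M : 'M[R]_n) (z : R[i]) :
  eigenvalue (map_mx Cx M) z ->
  exists p : 'rV[R]_n * 'rV[R]_n,
    [/\ (p.1 != 0) || (p.2 != 0),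
        p.1 *m M = complex.Re z *: p.1 - complex.Im z *: p.2
      & p.2 *m M = complex.Im z *: p.1 + complex.Re z *: p.2].
Proof.
case/eigenvalueP => v vM v0.
exists (map_mx (@complex.Re R) v, map_mx (@complex.Im R) v); split => /=.
- apply: contraNT v0; rewrite negb_or !negbK => /andP[/eqP v1 /eqP v2].
  apply/eqP/rowP => i; move/rowP/(_ i): v1; move/rowP/(_ i): v2.
  by rewrite !mxE; case: (v 0 i) => a b /= -> ->.
- apply/rowP => j; move/rowP/(_ j)/(congr1 (@complex.Re R)): vM.
  rewrite !mxE raddf_sum /= => eqj.
  transitivity (complex.Re (z * v 0 j)); last by case: z (v 0 j) {eqj} => a b [].
  rewrite -eqj; apply: eq_bigr => i _; rewrite !mxE.
  by case: (v 0 i) => a b /=; rewrite mulr0 subr0.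
- apply/rowP => j; move/rowP/(_ j)/(congr1 (@complex.Im R)): vM.
  rewrite !mxE raddf_sum /= => eqj.
  transitivity (complex.Im (z * v 0 j)).
    rewrite -eqj; apply: eq_bigr => i _; rewrite !mxE.
    by case: (v 0 i) => a b /=; rewrite mulr0 add0r.
  by case: z (v 0 j) {eqj} => a b [c d] /=; rewrite addrC.
Qed.

Lemma leigenvalueE A a :
  leigenvalue A a = eigenvalue (mxof e e A) a.
Proof.
have eb := vbasisP {:V}.
by rewrite /leigenvalue (leigenspaceE eb) vsof_eq0.
Qed.

Lemma selfadjoint_eigenvalue_real g A z :
  (forall u v, g (A u) v = g u (A v)) ->
  eigenvalue (map_mx Cx (mxof e e A)) z -> complex.Im z = 0.
Proof.
move=> gA /complex_eigenvalue_split [[u w] /= [uw0 uM wM]].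
have eb := vbasisP {:V}.
pose x := vecof e u; pose y := vecof e w.
have Ax : A x = complex.Re z *: x - complex.Im z *: y.
  by rewrite (hom_vecof e eb) uM linearB !linearZ.
have Ay : A y = complex.Im z *: x + complex.Re z *: y.
  by rewrite (hom_vecof e eb) wM linearD !linearZ.
have xy0 : (0 < g x x) || (0 < g y y) by rewrite !dot_gt0 !vecof_eq0.
(* The terms in [complex.Re z] cancel between the two sides, leaving the imaginary part times a
   positive number. *)
have := gA x y; rewrite Ax Ay linearBl !linearZl_LR linearD !linearZ /= => eq1.
have /eqP : complex.Im z * (g x x + g y y) = 0 by lra.
rewrite mulf_eq0 => /orP[/eqP //|/eqP s0].
have := dot_ge0 g x; have := dot_ge0 g y.
by case/orP: xy0; lra.
Qed.

Lemma selfadjoint_char_poly g A :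
  (forall u v, g (A u) v = g u (A v)) ->
  exists2 s : seq R, all (leigenvalue A) s
    & char_poly (mxof e e A) = \prod_(a <- s) ('X - a%:P).
Proof.
move=> gA; set M := mxof e e A.
have [s] := closed_field_poly_normal (char_poly (map_mx Cx M)).
rewrite (monicP (char_poly_monic _)) scale1r => sE.
have sR z : z \in s -> z = Cx (complex.Re z).
  move=> zs; have : eigenvalue (map_mx Cx M) z.
    by rewrite eigenvalue_root_char sE root_prod_XsubC.
  by move=> /(selfadjoint_eigenvalue_real gA); case: z zs => a b _ /= ->.
have ME : char_poly M = \prod_(a <- [seq complex.Re z | z <- s]) ('X - a%:P).
  apply: (map_poly_inj Cx); rewrite map_char_poly sE rmorph_prod big_map.
  apply: eq_big_seq => z zs /=.
  by rewrite rmorphB /= map_polyX map_polyC /= -(sR z zs).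
exists [seq complex.Re z | z <- s] => //; apply/allP => a sa.
by rewrite leigenvalueE eigenvalue_root_char ME root_prod_XsubC.
Qed.

Lemma selfadjoint_trace g A :
  (forall u v, g (A u) v = g u (A v)) ->
  exists s : seq R, [/\ size s = \dim {:V}, all (leigenvalue A) s
    & lfun_trace A = \sum_(a <- s) a].
Proof.
move=> gA; have [s sA cE] := selfadjoint_char_poly gA; exists s.
have szs : size s = \dim {:V}.
  by apply: succn_inj; rewrite -(size_prod_XsubC s id) -cE size_char_poly.
split=> //; rewrite /lfun_trace.
(* The trace is read off, up to sign, from the coefficient of degree [\dim {:V} - 1], which makes
   sense only in positive dimension. *)
have [n0|n0] := posnP (\dim {:V}).
  rewrite (size0nil (etrans szs n0)) big_nil /mxtrace big1 // => i _.
  by have := ltn_ord i; rewrite {2}n0.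
apply: oppr_inj; rewrite -char_poly_trace // cE -[X in _`_X.-1]szs.
by rewrite coefPn_prod_XsubC // szs -lt0n.
Qed.

Lemma finitely_many_sums (S : seq R) n :
  exists T : seq R, forall s : seq R, size s = n -> {subset s <= S} ->
    \sum_(a <- s) a \in T.
Proof.
elim: n => [|n [T TP]].
  by exists [:: 0] => s /size0nil -> _; rewrite big_nil mem_head.
exists [seq a + b | a <- S, b <- T] => -[//|a s] [szs] sS.
rewrite big_cons allpairs_f ?sS ?mem_head // TP // => b bs.
by rewrite sS // inE bs orbT.
Qed.

(** Only the sets of eigenvalues are known to agree, so multiplicities could vary with the index.
    Still, every trace is a sum of [\dim {:V}] roots of the characteristic polynomial of one
    reference operator [F i]. *)
Lemma isospectral_trace_finite g (I : Type) (P : I -> Prop) (F : I -> 'End(V)) :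
  (forall i, P i -> forall u v, g (F i u) v = g u (F i v)) ->
  (forall i j, P i -> P j ->
     forall a : R, leigenvalue (F i) a = leigenvalue (F j) a) ->
  forall i, P i -> exists T : seq R, forall j, P j -> lfun_trace (F j) \in T.
Proof.
move=> Fsym Feig i Pi.
have [S _ SE] := selfadjoint_char_poly (Fsym i Pi).
have [T TP] := finitely_many_sums S (\dim {:V}).
exists T => j Pj; have [s [szs sA ->]] := selfadjoint_trace (Fsym j Pj).
apply: TP => // a /(allP sA); rewrite (Feig j i) // leigenvalueE.
by rewrite eigenvalue_root_char SE root_prod_XsubC.
Qed.

Lemma lfun_trace_mulC (A B : 'End(V)) :
  lfun_trace (A \o B)%VF = lfun_trace (B \o A)%VF.
Proof. by rewrite /lfun_trace !(mxof_comp e _ (vbasisP _)) mxtrace_mulC. Qed.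

Lemma lfun_traceN (A : 'End(V)) : lfun_trace (- A) = - lfun_trace A.
Proof. by rewrite /lfun_trace linearN raddfN. Qed.

Lemma lfun_traceD (A B : 'End(V)) :
  lfun_trace (A + B) = lfun_trace A + lfun_trace B.
Proof. by rewrite -{1}[A]scale1r lfun_traceP mul1r. Qed.

End SymmetricOperators.

(** * Quadratic forms with finitely many values on the unit sphere *)

Section ProportionalForms.
Context {R : realType} {V : vectType R}.
Implicit Types (g : {dot V for idfun}) (rho : V -> V -> R).

Lemma symmetric_bilinear_dot g : symmetric_bilinear g.
Proof.
split=> [y a u v|x a u v|]; last exact: dotC.
- by rewrite linearPl.
- by rewrite linearPr.
Qed.

Lemma bilin_line rho (x y : V) (t : R) : symmetric_bilinear rho ->
  rho (x + t *: y) (x + t *: y) =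
  rho y y * t ^+ 2 + 2 * rho x y * t + rho x x.
Proof.
move=> [bl br bs]; rewrite (addrC x) bl !br (bs y x) /=; ring.
Qed.

Lemma poly_vanishing_eq0 (p : {poly R}) : (forall t, p.[t] = 0) -> p = 0.
Proof.
(* In characteristic 0 the naturals below [size p] are distinct, and they are too many roots for a
   nonzero [p]. *)
move=> p0; apply: (@roots_geq_poly_eq0 _ p [seq i%:R | i <- iota 0 (size p)]).
- by apply/allP => a _; apply/rootP.
- by rewrite map_inj_uniq ?iota_uniq //; apply: mulrIn; apply: oner_neq0.
- by rewrite size_map size_iota.
Qed.

(* Along the line x + t y both forms are quadratic polynomials in t, and the
   product over s in T of the polynomials rho - s g vanishes identically, so
   that one factor does. *)
Lemma finite_ratio_pair g rho (T : seq R) : symmetric_bilinear rho ->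
  (forall x, exists2 s, s \in T & rho x x = s * g x x) ->
  forall x y, exists s, rho x x = s * g x x /\ rho y y = s * g y y.
Proof.
move=> rhoP rhoT x y; have gP := symmetric_bilinear_dot g.
pose P s := (rho y y - s * g y y) *: 'X^2
  + (2 * rho x y - s * (2 * g x y)) *: 'X + (rho x x - s * g x x)%:P.
have PE s t : (P s).[t] =
    rho (x + t *: y) (x + t *: y) - s * g (x + t *: y) (x + t *: y).
  rewrite (bilin_line _ _ _ rhoP) (bilin_line _ _ _ gP) /P !hornerD !hornerZ.
  rewrite hornerXn hornerX hornerC; ring.
have /eqP : \prod_(s <- T) P s = 0.
  apply: poly_vanishing_eq0 => t; rewrite horner_prod.
  have [s sT sE] := rhoT (x + t *: y).
  by rewrite (big_rem s) //= PE sE subrr mul0r.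
rewrite prodf_seq_eq0 => /hasP[s sT /eqP Ps]; exists s; split.
  (* The value of [P s] at 0 gives the equation for [x], its coefficient of degree 2 the one for
     [y]. *)
  have := PE s 0; rewrite Ps horner0 scale0r addr0 => eq0; lra.
have /(congr1 (fun p : {poly R} => p`_2)) := Ps.
rewrite !coefD !coefZ coefXn coefX coefC coef0 /= => eq0; lra.
Qed.

Lemma finite_on_sphere_proportional g rho (T : seq R) : symmetric_bilinear rho ->
  (forall x, unit_vector g x -> rho x x \in T) ->
  exists c, forall x, rho x x = c * g x x.
Proof.
move=> rhoP rhoT; have [bl br bs] := rhoP.
(* Linearity with scalar -1 at zero vectors reads [rho 0 x = - rho 0 x + rho 0 x]. *)
have rho0 x : rho 0 x = 0 by have := bl x (-1) 0 0; rewrite scaler0 addr0; lra.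
(* Scaling carries the ratio from the sphere to all nonzero vectors; the added 0 serves the zero
   vector, as [T] may be empty. *)
have rhoT0 x : exists2 s, s \in 0 :: T & rho x x = s * g x x.
  have [->|/(dot_norm g)[a a0 [u u1 ->]]] := eqVneq x 0.
    by exists 0; rewrite ?mem_head // rho0 mul0r.
  exists (rho u u); first by rewrite inE rhoT ?orbT.
  rewrite linearZl_LR linearZ /= u1.
  have := bl (a *: u) a u 0; rewrite addr0 rho0 => ->.
  have := br u a u 0; rewrite (bs u 0) addr0 rho0 => ->; ring.
have pairs := finite_ratio_pair rhoP rhoT0.
have [[u u0]|V0] := pselect (exists u : V, u != 0).
  exists (rho u u / g u u) => x; have [s [-> ->]] := pairs x u.
  by rewrite mulfK // gt_eqF // dot_gt0.
exists 0 => x; have [->|x0] := eqVneq x 0; first by rewrite rho0 mul0r.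
by case: V0; exists x.
Qed.

Lemma proportional_polarization g rho c : symmetric_bilinear rho ->
  (forall x, rho x x = c * g x x) -> forall x y, rho x y = c * g x y.
Proof.
move=> rhoP rhoE x y; have := rhoE (x + 1 *: y).
rewrite (bilin_line _ _ _ rhoP) (bilin_line _ _ _ (symmetric_bilinear_dot g)).
rewrite !rhoE; lra.
Qed.

End ProportionalForms.

(** * J-invariance of the curvature and the Ricci form *)

Section ComplexOsserman.
Context {R : realType} {V : vectType R}.
Context (g : {dot V for idfun}) (J : 'End(V)) (Rm : V -> V -> V -> V -> R).
Context (CO : complex_osserman g J Rm).

Let RmP : algebraic_curvature_tensor Rm. Proof. by case: CO. Qed.

Lemma Jdot x y : g (J x) (J y) = g x y.
Proof. by case: CO => -[iso _] _ _ _; apply: iso. Qed.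

Lemma JJ x : J (J x) = - x.
Proof.
by case: CO => -[_ /lfunP/(_ x)] + _ _ _; rewrite comp_lfunE opp_lfunE id_lfunE.
Qed.

Lemma jacobi_selfadjoint x u v : g (jacobi g Rm x u) v = g u (jacobi g Rm x v).
Proof.
have [_ a12 pair _] := RmP.
rewrite (dotC g u) !jacobiE // pair a12 pair a12 pair opprK.
by rewrite a12 pair a12 opprK.
Qed.

Lemma jacobi_plane_selfadjoint x u v :
  g (jacobi_plane g J Rm x u) v = g u (jacobi_plane g J Rm x v).
Proof.
by rewrite /jacobi_plane !add_lfunE linearDl linearD /= !jacobi_selfadjoint.
Qed.

Lemma jacobi_plane_sectional x y :
  Rm y x x y + Rm y (J x) (J x) y
  = Rm (J y) x x (J y) + Rm (J y) (J x) (J x) (J y).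
Proof.
have [[l1 l2 l3 l4] a12 pair _] := RmP.
have unit_case u : unit_vector g u ->
    Rm y u u y + Rm y (J u) (J u) y
    = Rm (J y) u u (J y) + Rm (J y) (J u) (J u) (J y).
  move=> u1; have [_ _ /(_ u u1)/lfunP/(_ y) com _] := CO.
  (* Pairing the commutation relation at [y] with [J y] lets the isometry remove [J] from one
     side. *)
  have := congr1 (fun w => g w (J y)) com.
  by rewrite !comp_lfunE Jdot /jacobi_plane !add_lfunE !linearDl /= !jacobiE.
have Z2 a u v w t : Rm u (a *: v) w t = a * Rm u v w t.
  have := l2 u w t a v 0; have := l2 u w t (-1) 0 0.
  by rewrite scaler0 !addr0 => + ->; lra.
have Z3 a u v w t : Rm u w (a *: v) t = a * Rm u w v t.
  have := l3 u w t a v 0; have := l3 u w t (-1) 0 0.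
  by rewrite scaler0 !addr0 => + ->; lra.
(* Both sides are homogeneous of degree 2 in [x], so the unit case suffices. *)
have [->|/(dot_norm g)[a a0 [u /unit_case uE ->]]] := eqVneq x 0.
  by rewrite linear0 -(scale0r 0) !Z2 !mul0r.
rewrite linearZ /= !Z2 !Z3; move: uE; nra.
Qed.

Lemma sectional_sym x y : Rm x y y x = Rm y x x y.
Proof. by have [_ a12 pair _] := RmP; rewrite pair. Qed.

(* Adding the commutation relation at (x, y) to the one at (y, x) leaves only
   the J-invariance of the (unnormalised) sectional curvature. *)
Lemma sectional_J x y : Rm (J y) (J x) (J x) (J y) = Rm y x x y.
Proof.
have := jacobi_plane_sectional x y; have := jacobi_plane_sectional y x.
rewrite !(sectional_sym x) !(sectional_sym (J x)); lra.
Qed.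

(** Polarization of [sectional_J] in [y]: expand it at [y + z] and use the symmetry of the Jacobi
    form. *)
Lemma curvature_J x y z : Rm (J y) (J x) (J x) (J z) = Rm y x x z.
Proof.
have [[l1 l2 l3 l4] a12 pair _] := RmP.
have D1 u v w t s : Rm (u + v) w t s = Rm u w t s + Rm v w t s.
  by have := l1 w t s 1 u v; rewrite scale1r mul1r.
have D4 u v w t s : Rm w t s (u + v) = Rm w t s u + Rm w t s v.
  by have := l4 w t s 1 u v; rewrite scale1r mul1r.
have sym u v w : Rm v u u w = Rm w u u v.
  by rewrite pair a12 pair a12 pair opprK.
have := sectional_J x (y + z); rewrite linearD !D1 !D4 !sectional_J.
rewrite (sym (J x) (J z)) (sym x z); lra.
Qed.

Lemma jacobi_J x : (jacobi g Rm (J x) \o J = J \o jacobi g Rm x)%VF.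
Proof.
apply/lfunP => y; apply: (dot_inj (g := g)) => z.
have -> : z = J (- J z) by rewrite linearN /= JJ opprK.
by rewrite !comp_lfunE Jdot !jacobiE // curvature_J.
Qed.

(** As [- J] is the inverse of [J], [jacobi_J] exhibits the two operators as conjugate, and the
    trace is cyclic. *)
Lemma trace_jacobi_J x :
  lfun_trace (jacobi g Rm (J x)) = lfun_trace (jacobi g Rm x).
Proof.
have -> : jacobi g Rm (J x) = (- (J \o (jacobi g Rm x \o J)))%VF.
  apply/lfunP => y; rewrite opp_lfunE comp_lfunA -jacobi_J.
  by rewrite !comp_lfunE JJ linearN /= opprK.
rewrite lfun_traceN lfun_trace_mulC -lfun_traceN; congr lfun_trace.
by apply/lfunP => y; rewrite opp_lfunE !comp_lfunE JJ linearN /= opprK.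
Qed.

Lemma ricci_half_trace x :
  ricci g Rm x x = lfun_trace (jacobi_plane g J Rm x) / 2.
Proof.
by rewrite lfun_traceD trace_jacobi_J (ricciP g RmP).2; field.
Qed.

Lemma ricci_finite : exists T : seq R,
  forall x, unit_vector g x -> ricci g Rm x x \in T.
Proof.
(* A unit vector is needed as reference point for the spectrum; without one the claim is vacuous. *)
have [[u u1]|noU] := pselect (exists u, unit_vector g u); last first.
  by exists [::] => x x1; case: noU; exists x.
have [_ _ _ eig] := CO.
have [T TP] := isospectral_trace_finite
  (fun x _ => jacobi_plane_selfadjoint x) eig u1.
exists [seq t / 2 | t <- T] => x x1.
by rewrite ricci_half_trace; apply: (map_f (fun t => t / 2)); apply: TP.
Qed.

End ComplexOsserman.

Theorem lemma2p3 (R : realType) (V : vectType R)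
    (g : {dot V for idfun}) (J : 'End(V)) (Rm : V -> V -> V -> V -> R) :
  complex_osserman g J Rm -> einstein g Rm.
Proof.
move=> CO; have [_ RmP _ _] := CO.
have [ricP _] := ricciP g RmP; have [T TP] := ricci_finite CO.
have [c cE] := finite_on_sphere_proportional ricP TP.
by exists c; apply: proportional_polarization.
Qed.
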